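(* Let $\epsilon>0$ be any small constant. For every $s\leq n^{1/2-\epsilon}$, the deterministic two-party communication complexity of $s$-sparse unique-disjointness on $[n]$ is $\Omega(s\cdot\log(n/s))$.
   Context: In $s$-sparse unique-disjointness, Alice holds $x\in\{0,1\}^n$ and Bob holds $y\in\{0,1\}^n$ (subsets of $[n]$) with Hamming weights $|x|,|y|\leq s$. \textsf{No} instances: $\{(x,y): |x|,|y|\le s,\ \forall i,\ x(i)+y(i)\le 1\}$; \textsf{yes} instances: $\{(x,y): |x|,|y|\le s,\ \exists \ell,\ x(\ell)=y(\ell)=1 \text{ and } \forall i\neq\ell,\ x(i)+y(i)\le 1\}$. A deterministic protocol must output $0$ on all \textsf{no} instances and $1$ on all \textsf{yes} instances (promise problem). The implied constant in $\Omega$ may depend on $\epsilon$ but not on $n,s$. *)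

(* Defs.v *)
From mathcomp Require Import all_boot all_order all_algebra.
From mathcomp Require Import boolp.

Set Implicit Arguments.
Unset Strict Implicit.
Unset Printing Implicit Defensive.

Section Protocols.
Variables X Y : finType.

(* At an internal node the owner sends one bit, a function of its own input;
   the protocol continues in the first subtree on bit 0 and in the second one
   on bit 1. *)
Inductive protocol : Type :=
| Output of bool
| Alice of (X -> bool) & protocol & protocol
| Bob of (Y -> bool) & protocol & protocol.

Fixpoint run (p : protocol) (x : X) (y : Y) : bool :=
  match p with
  | Output b => b
  | Alice a p0 p1 => if a x then run p1 x y else run p0 x y
  | Bob b p0 p1 => if b y then run p1 x y else run p0 x y
  end.

(* Worst-case number of bits exchanged: the depth of the tree. *)
Fixpoint cost (p : protocol) : nat :=
  match p with
  | Output _ => 0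
  | Alice _ p0 p1 | Bob _ p0 p1 => (maxn (cost p0) (cost p1)).+1
  end.

(* A promise problem is a partial Boolean function; [None] marks the inputs
   outside the promise, where the output of a protocol is unconstrained. *)
Definition solves (f : X -> Y -> option bool) (p : protocol) : Prop :=
  forall x y b, f x y = Some b -> run p x y = b.

Definition cost_solvable (f : X -> Y -> option bool) : pred nat :=
  fun d => `[< exists p, solves f p /\ cost p = d >].

Lemma cost_solvable_ex (f : X -> Y -> option bool) :
  exists d, cost_solvable f d.
Proof.
pose tell x0 p := Alice (fun x => x == x0) p
  (Bob (fun y => f x0 y == Some true) (Output false) (Output true)).
pose p := foldr tell (Output false) (enum X).
exists (cost p); apply/asboolP; exists p; split=> // x y b fxy.
have : x \in enum X by rewrite mem_enum.
rewrite /p; elim: (enum X) => //= x0 l IHl; rewrite inE.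
case: eqP => [<- _ | _ /= /IHl //].
by rewrite fxy; case: b {fxy IHl}.
Qed.

Definition det_cc (f : X -> Y -> option bool) : nat :=
  ex_minn (cost_solvable_ex f).

End Protocols.

Section UniqueDisjointness.
Variable n : nat.
Implicit Types x y : {ffun 'I_n -> bool}.

Definition hamming_weight x : nat := \sum_i x i.

Definition udisj_no (s : nat) x y : bool :=
  [&& hamming_weight x <= s, hamming_weight y <= s &
      [forall i, x i + y i <= 1]].

Definition udisj_yes (s : nat) x y : bool :=
  [&& hamming_weight x <= s, hamming_weight y <= s &
      [exists l, [&& x l, y l &
         [forall i, (i != l) ==> (x i + y i <= 1)]]]].

Definition udisj (s : nat) x y : option bool :=
  if udisj_no s x y then Some false
  else if udisj_yes s x y then Some true
  else None.

Lemma udisj_noP s x y : udisj s x y = Some false <-> udisj_no s x y.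
Proof. by rewrite /udisj; case: udisj_no => //; case: udisj_yes. Qed.

Lemma udisj_yesP s x y : udisj s x y = Some true <-> udisj_yes s x y.
Proof.
rewrite /udisj; case: (boolP (udisj_no s x y)) => [|_]; last first.
  by case: udisj_yes.
case/and3P=> _ _ /forallP no; split=> // /and3P[_ _ /existsP[l /and3P[xl yl _]]].
by have := no l; rewrite xl yl.
Qed.

End UniqueDisjointness.

(* Main.v *)
(** Split [n] into [s] blocks of [m = n %/ s] points, so that a tuple in [m]^s
    becomes an [s]-sparse set and a pair of tuples is a yes instance when it
    agrees in exactly one coordinate. The adversary keeps a set [D] of
    coordinates and a rectangle [X x Y] with [x j <> y j] on [D], and measures
    it by its keys: the restrictions to the complement of [D] common to [X] and
    [Y]. Off [D] it works on the diagonal, so a bit sent by either player costs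
    only a factor 2 of the keys. Both [X] and [Y] stay rich: off [D] each single
    coordinate of each point can be changed inside the set. In a rich rectangle
    with a key and a coordinate left, changing the coordinates one at a time
    produces both a no and a yes instance.
    A coordinate [i] along which the keys lie on more than a [4 / M] fraction of
    lines, [M = 16 s], is moved into [D]: for a random [A], keeping [x i] in [A]
    and [y i] outside [A] preserves a quarter of the lines, by richness, so
    [#keys * M ^ #|D|] does not decrease. If there is no such coordinate, then
    after a bit richness is restored at the cost of another factor 2.
    Hence [m ^ s <= (16 s) ^ s * 4 ^ cost], and [s <= n ^ (1/2 - eps)] makes
    [m / (16 s)] a power of [n], up to a constant. *)
Require Import Defs.
From mathcomp Require Import all_boot all_order all_algebra.
From mathcomp Require Import reals exp.
From mathcomp Require Import boolp sequences zify lra.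
Import Order.TTheory GRing.Theory Num.Theory.
Local Open Scope ring_scope.

(** * Tuples with erased coordinates, and rich sets *)

Section Erasure.
Local Open Scope nat_scope.
Variables (T Q : finType) (q0 : Q).
Local Notation point := {ffun T -> Q}.
Implicit Types (D I : {set T}) (x y k : point) (K X Y : {set point}).

(* [q0] is a dummy value that stands for an erased coordinate. *)
Definition erase D x : point := [ffun i => if i \in D then q0 else x i].

Lemma eraseP D x y :
  reflect (forall j, j \notin D -> x j = y j) (erase D x == erase D y).
Proof.
apply: (iffP eqP) => [/ffunP e j jD | e].
  by have := e j; rewrite !ffunE (negbTE jD).
by apply/ffunP => j; rewrite !ffunE; case: ifPn => // /e.
Qed.

Lemma erase0 x : erase set0 x = x.
Proof. by apply/ffunP => j; rewrite ffunE inE. Qed.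

Lemma eraseU1 i D x : erase (i |: D) x = erase [set i] (erase D x).
Proof. by apply/ffunP => j; rewrite !ffunE !inE; case: eqP. Qed.

(** The coordinates in [D] are free to change together with coordinate [i]. *)
Definition rich D X : Prop := forall x i, x \in X -> i \notin D ->
  exists2 x', x' \in X & x' i != x i /\ erase (i |: D) x' = erase (i |: D) x.

(** Each rich move changes a single coordinate off [D], so the coordinates of [J] can be changed one
    by one without undoing earlier changes. *)
Lemma rich_move D X x (J : seq T) : rich D X -> x \in X -> uniq J ->
    {in J, forall j, j \notin D} ->
  exists2 x', x' \in X &
    {in J, forall j, x' j != x j} /\
    forall j, j \notin D -> j \notin J -> x' j = x j.
Proof.
move=> rX xX; elim: J => [|i J IH] /=; first by exists x.
case/andP=> iJ uJ JD.
have [|x1 x1X [ne1 eq1]] := IH uJ; first by move=> j jJ; apply: JD; rewrite inE jJ orbT.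
have iD : i \notin D by apply: JD; rewrite inE eqxx.
have [x2 x2X [ne2 /eqP/eraseP eq2]] := rX _ _ x1X iD.
have x2E j : j != i -> j \notin D -> x2 j = x1 j.
  by move=> ji jD; apply: eq2; rewrite !inE negb_or ji.
exists x2 => //; split=> [j|j jD].
  rewrite inE => /predU1P[->|jJ]; first by rewrite -(eq1 _ iD iJ).
  rewrite x2E ?ne1 //; first by apply: contraNneq iJ => <-.
  by apply: JD; rewrite inE jJ orbT.
by rewrite inE negb_or => /andP[ji jJ]; rewrite x2E ?eq1.
Qed.

Lemma rich_slice D X i (A : {set Q}) : i \notin D -> rich D X ->
  rich (i |: D) [set x in X | x i \in A].
Proof.
move=> iD rX x j; rewrite !inE negb_or => /andP[xX xA] /andP[ji jD].
have [x' x'X [ne /eqP/eraseP eq']] := rX _ _ xX jD.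
exists x'; first by rewrite inE x'X eq' // !inE negb_or eq_sym ji.
split=> //; apply/eqP/eraseP => l.
by rewrite !inE !negb_or => /and3P[lj li lD]; apply: eq'; rewrite !inE negb_or lj.
Qed.

(** * Keys of a rectangle: fixing a coordinate, restoring richness *)

Definition keys D X Y : {set point} := erase D @: X :&: erase D @: Y.

Lemma keys_setT : keys set0 setT setT = setT.
Proof.
rewrite /keys setIid; apply/setP => x; rewrite [RHS]inE.
by apply/imsetP; exists x => //; rewrite erase0.
Qed.

Lemma card_separators (u v : Q) : u != v ->
  4 * #|[set A : {set Q} | (u \in A) && (v \notin A)]| = 2 ^ #|Q|.
Proof.
move=> uv.
have -> : [set A : {set Q} | (u \in A) && (v \notin A)]
        = [set u |: B | B in powerset (~: [set u; v])].
  apply/setP => A; rewrite inE; apply/andP/imsetP => [[uA vA]|[B]].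
    exists (A :\ u); last by rewrite setD1K.
    rewrite inE; apply/subsetP => w; rewrite !inE => /andP[wu wA].
    by rewrite negb_or wu; apply: contraNneq vA => <-.
  rewrite inE => /subsetP sB ->; rewrite !inE eqxx negb_or eq_sym uv; split=> //=.
  by apply/negP => /sB; rewrite !inE eqxx orbT.
rewrite card_in_imset ?card_powerset.
  have := cardsC [set u; v]; rewrite cards2 uv => <-.
  by rewrite expnD.
move=> B C; rewrite !inE => /subsetP sB /subsetP sC eBC.
have uB : u \notin B by apply/negP => /sB; rewrite !inE eqxx.
have uC : u \notin C by apply/negP => /sC; rewrite !inE eqxx.
by rewrite -(setU1K uB) eBC setU1K.
Qed.

(* A uniformly random [A] contains [u] and misses [v] with probability 1/4. *)
Lemma exists_separator (S : finType) (B : {set S}) (F : {set Q} -> {set S}) :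
    (forall b, b \in B -> exists u v, u != v /\
       forall A : {set Q}, u \in A -> v \notin A -> b \in F A) ->
  exists A, #|B| <= 4 * #|F A|.
Proof.
move=> sepB; apply/existsP; apply: contraT; rewrite negb_exists => /forallP small.
have : \sum_(A : {set Q}) (4 * #|F A|).+1 <= \sum_(A : {set Q}) #|B|.
  by apply: leq_sum => A _; rewrite ltnNge.
under eq_bigr do rewrite -addn1.
rewrite big_split /= -big_distrr /= !sum_nat_const.
have -> : #|{set Q}| = 2 ^ #|Q|.
  rewrite -(cardsT {set Q}).
  have <- : powerset [set: Q] = [set: {set Q}] by apply/setP => A; rewrite !inE subsetT.
  by rewrite card_powerset cardsT.
have : #|B| * 2 ^ #|Q| <= 4 * \sum_(A : {set Q}) #|F A|.
  have -> : \sum_(A : {set Q}) #|F A| = \sum_b #|[set A | b \in F A]|.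
    under eq_bigr do rewrite -sum1_card big_mkcond.
    rewrite exchange_big /=; apply: eq_bigr => b _.
    by rewrite -sum1_card big_mkcond /=; apply: eq_bigr => A _; rewrite inE.
  rewrite -sum_nat_const big_distrr /= big_mkcond /=; apply: leq_sum => b _.
  case: ifP => // /sepB[u [v [uv FA]]]; rewrite -(card_separators _ _ uv) leq_mul2l /=.
  by apply/subset_leq_card/subsetP => A; rewrite !inE => /andP[]; apply: FA.
have := expn_gt0 2 #|Q|; move: (2 ^ _) (\sum_(_ : _) _) => q f; nia.
Qed.

(** A line of keys comes from some [x] and [y] with [x i = y i]; richness of [Y] moves [y i] to
    another value, and any [A] that contains [x i] and misses the new value keeps the line. *)
Lemma exists_query D X Y i : i \notin D -> rich D Y ->
  exists A : {set Q}, #|erase [set i] @: keys D X Y| <=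
    4 * #|keys (i |: D) [set x in X | x i \in A] [set y in Y | y i \in ~: A]|.
Proof.
move=> iD rY.
apply: (@exists_separator _ _ (fun A => keys (i |: D) [set x in X | x i \in A]
  [set y in Y | y i \in ~: A])) => k /imsetP[k'].
rewrite inE => /andP[/imsetP[x xX ->] /imsetP[y yY exy]] ->.
have [y' y'Y [ney eqy]] := rY _ _ yY iD.
exists (x i), (y' i); split.
  by move/eqP/eraseP: exy => ->; rewrite // eq_sym.
move=> A xA yA; rewrite inE -eraseU1; apply/andP; split.
  by apply: imset_f; rewrite inE xX.
rewrite eraseU1 exy -eraseU1 -eqy; apply: imset_f.
by rewrite !inE y'Y.
Qed.

(* Deleting a point that is alone in its fibre in direction [i] also deletes
   that fibre, so [#|K| - \sum_(i in I) #|erase [set i] @: K|] never drops. *)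
Lemma exists_rich_subset I K : exists2 K' : {set point}, K' \subset K &
  (forall k i, k \in K' -> i \in I ->
     exists2 k', k' \in K' & k' != k /\ erase [set i] k' = erase [set i] k) /\
  #|K| <= #|K'| + \sum_(i in I) #|erase [set i] @: K|.
Proof.
suff [K' sK [gK leK]] : exists2 K' : {set point}, K' \subset K &
  (forall k i, k \in K' -> i \in I ->
     exists2 k', k' \in K' & k' != k /\ erase [set i] k' = erase [set i] k) /\
  #|K| + \sum_(i in I) #|erase [set i] @: K'| <=
  #|K'| + \sum_(i in I) #|erase [set i] @: K|.
  by exists K' => //; split=> //; apply: leq_trans leK; apply: leq_addr.
elim: {K}_.+1 {-2}K (ltnSn #|K|) => // N IH K ltKN.
pose ok k i := [exists k' in K, (k' != k) && (erase [set i] k' == erase [set i] k)].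
case: (boolP [forall k in K, forall i in I, ok k i]) => [/forall_inP allok | ].
  exists K => //; split=> // k i kK iI.
  have /forall_inP/(_ i iI)/exists_inP[k' k'K /andP[ne /eqP e]] := allok k kK.
  by exists k'.
rewrite negb_forall_in => /exists_inP[k kK].
rewrite negb_forall_in => /exists_inP[i iI nok].
have cK := cardsD1 k K; rewrite kK in cK.
have [|K' sK [gK leK]] := IH (K :\ k); first by move: ltKN; rewrite cK; lia.
exists K'; first by apply: subset_trans sK (subD1set _ _).
split=> //.
have drop j : erase [set j] @: (K :\ k) \subset erase [set j] @: K.
  exact/imsetS/subD1set.
have dropi : #|erase [set i] @: (K :\ k)| < #|erase [set i] @: K|.
  apply: proper_card; apply/properP; split=> //.
  exists (erase [set i] k); first exact: imset_f.
  apply: contra nok => /imsetP[k']; rewrite !inE => /andP[ne k'K] e.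
  by apply/exists_inP; exists k' => //; rewrite ne e eqxx.
have : \sum_(j in I) #|erase [set j] @: (K :\ k)| <
       \sum_(j in I) #|erase [set j] @: K|.
  rewrite (bigD1 i iI) [X in _ < X](bigD1 i iI) /= -addSn leq_add //.
  by apply: leq_sum => j _; apply/subset_leq_card.
move: leK; rewrite cK; lia.
Qed.

(** Carries richness from a set of keys over to the points of [X] above it. *)
Lemma rich_preimage D X K :
    (forall k, k \in K -> exists2 x, x \in X & erase D x = k) ->
    (forall k i, k \in K -> i \in ~: D ->
     exists2 k', k' \in K & k' != k /\ erase [set i] k' = erase [set i] k) ->
  rich D [set x in X | erase D x \in K] /\
  erase D @: [set x in X | erase D x \in K] = K.
Proof.
move=> onto gK; split=> [x i|].
  rewrite inE => /andP[xX kK] iD.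
  have [|k' k'K [ne e]] := gK _ i kK; first by rewrite inE.
  have [x' x'X ex'] := onto _ k'K.
  exists x'; first by rewrite inE x'X ex'.
  split; last by rewrite !eraseU1 ex'.
  apply: contra ne => /eqP exi; rewrite -ex'; apply/eraseP => j jD.
  have [->//|ji] := eqVneq j i.
  move: e; rewrite -ex' -!eraseU1 => /eqP/eraseP; apply.
  by rewrite !inE negb_or ji.
apply/setP => k; apply/imsetP/idP => [[x]|kK]; first by rewrite inE => /andP[_ ?] ->.
by have [x xX e] := onto _ kK; exists x => //; rewrite inE xX e.
Qed.

(** * The adversary bound for a protocol tree *)

Section Adversary.
Variables (XT YT : finType) (eX : point -> XT) (eY : point -> YT) (M : nat).
Hypothesis M_large : 16 * #|T| <= M.

Definition decides_or_eq X Y (p : protocol XT YT) : Prop :=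
  forall x y, x \in X -> y \in Y ->
    ((forall i, x i != y i) -> run p (eX x) (eY y) = false) /\
    (forall l, x l = y l -> (forall i, i != l -> x i != y i) ->
       run p (eX x) (eY y) = true).

(** The lines in direction [i] that meet [K] hold on average at least [M / 4] of its points. *)
Definition few_lines D K : Prop :=
  forall i, i \in ~: D -> M * #|erase [set i] @: K| <= 4 * #|K|.

(** The side with more keys retains half of them, and making it rich retains half of those; the
    factor 4 is paid by the drop from [C] to a smaller cost. One statement serves both players: the
    silent one has [X0 = X1] or [Y0 = Y1]. *)
Lemma bit_step D X Y X0 X1 Y0 Y1 (C C0 C1 : nat) :
    C0 < C -> C1 < C ->
    keys D X Y \subset keys D X0 Y0 :|: keys D X1 Y1 ->
    (forall X' Y', X' \subset X0 -> Y' \subset Y0 -> rich D X' -> rich D Y' ->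
       #|keys D X' Y'| <= M ^ #|~: D| * 4 ^ C0) ->
    (forall X' Y', X' \subset X1 -> Y' \subset Y1 -> rich D X' -> rich D Y' ->
       #|keys D X' Y'| <= M ^ #|~: D| * 4 ^ C1) ->
    few_lines D (keys D X Y) ->
    X0 :|: X1 \subset X -> Y0 :|: Y1 \subset Y ->
  #|keys D X Y| <= M ^ #|~: D| * 4 ^ C.
Proof.
move=> ltC0 ltC1 sub IH0 IH1 thin sX sY.
wlog le01 : X0 X1 Y0 Y1 C0 C1 ltC0 ltC1 sub IH0 IH1 sX sY /
    #|keys D X1 Y1| <= #|keys D X0 Y0|.
  move=> W; case/orP: (leq_total #|keys D X1 Y1| #|keys D X0 Y0|) => le.
    exact: (W X0 X1 Y0 Y1 C0 C1).
  by apply: (W X1 X0 Y1 Y0 C1 C0) => //; rewrite setUC.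
set K := keys D X Y in sub thin *; set K0 := keys D X0 Y0 in sub le01 *.
have halfK : #|K| <= 2 * #|K0|.
  rewrite (leq_trans (subset_leq_card sub)) // (leq_trans (leq_card_setU _ _)) //.
  by rewrite mul2n -addnn leq_add2l.
have sK0 : K0 \subset K.
  by apply: setISS; apply: imsetS; [apply: subset_trans sX|apply: subset_trans sY];
     apply: subsetUl.
have [K' sK' [gK' leK']] := exists_rich_subset (~: D) K0.
(* Each direction has at most [4 * #|K| / M <= 8 * #|K0| / M] lines, there are at most [#|T|]
   directions, and [M >= 16 * #|T|]. *)
have sumK : 2 * \sum_(i in ~: D) #|erase [set i] @: K0| <= #|K0|.
  have [T0|T0] := posnP #|T|.
    by rewrite big1 // => i _; have := card0_eq T0 i; rewrite inE.
  suff : 16 * #|T| * \sum_(i in ~: D) #|erase [set i] @: K0| <= 8 * #|T| * #|K0|.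
    by rewrite (_ : 16 = 8 * 2) // (mulnAC 8) -mulnA leq_pmul2l ?muln_gt0.
  apply: (leq_trans (leq_mul M_large (leqnn _))).
  rewrite big_distrr /= (@leq_trans (\sum_(i in ~: D) 8 * #|K0|)) //.
    apply: leq_sum => i iD; apply: leq_trans (_ : 4 * #|K| <= _); last by lia.
    apply: leq_trans (thin i iD); rewrite leq_mul2l subset_leq_card ?orbT //.
    exact: imsetS.
  by rewrite sum_nat_const mulnA leq_mul2r mulnC leq_mul2l max_card !orbT.
have onto (Z : {set point}) : K0 \subset erase D @: Z ->
    forall k, k \in K' -> exists2 z, z \in Z & erase D z = k.
  by move=> /subsetP sZ k /(subsetP sK')/sZ/imsetP[z zZ ->]; exists z.
have [rX eX'] := rich_preimage _ _ _ (onto _ (subsetIl _ _)) gK'.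
have [rY eY'] := rich_preimage _ _ _ (onto _ (subsetIr _ _)) gK'.
have : #|K'| <= M ^ #|~: D| * 4 ^ C0.
  rewrite -(setIid K') -[X in X :&: _]eX' -[X in _ :&: X]eY'; apply: IH0 rX rY;
    by apply/subsetP => z; rewrite inE => /andP[].
have : 4 ^ C0.+1 <= 4 ^ C by rewrite leq_exp2l.
rewrite expnS; nia.
Qed.

Definition adversary_state p D X Y : Prop :=
  [/\ decides_or_eq X Y p, rich D X, rich D Y &
      forall x y j, x \in X -> y \in Y -> j \in D -> x j != y j].

(** Moving a direction with many lines into [D] keeps more than a [1 / M] fraction of the keys,
    which the lower exponent of [M] compensates. The process ends with few lines in every remaining
    direction. *)
Lemma query_step p (B : nat) :
    (forall D X Y, adversary_state p D X Y -> few_lines D (keys D X Y) ->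
       #|keys D X Y| <= M ^ #|~: D| * B) ->
  forall D X Y, adversary_state p D X Y -> #|keys D X Y| <= M ^ #|~: D| * B.
Proof.
move=> base D; have [N] := ubnP #|~: D|; elim: N D => // N IHN D ltN X Y st.
pose long i := 4 * #|keys D X Y| < M * #|erase [set i] @: keys D X Y|.
case: (boolP [exists i in ~: D, long i]) => [/exists_inP[i]|].
  rewrite inE => iD longi; case: st => dec rX rY dj.
  have [A leA] := exists_query D X Y i iD rY.
  have cD : #|~: D| = #|~: (i |: D)|.+1.
    have -> : ~: (i |: D) = (~: D) :\ i by apply/setP => j; rewrite !inE negb_or.
    by rewrite (cardsD1 i (~: D)) inE iD.
  have : #|keys (i |: D) [set x in X | x i \in A] [set y in Y | y i \in ~: A]|
     <= M ^ #|~: (i |: D)| * B.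
    apply: IHN; first by lia.
    split; [|exact: rich_slice|exact: rich_slice|].
      by move=> x y; rewrite !inE => /andP[xX _] /andP[yY _]; apply: dec.
    move=> x y j; rewrite !inE => /andP[xX xA] /andP[yY yA] /predU1P[->|jD].
      by apply: contraNneq yA => <-.
    exact: dj.
  rewrite cD expnS; move: longi leA; rewrite /long.
  by set k := #|keys _ _ _|; set k' := #|keys _ _ _|; nia.
rewrite negb_exists_in => /forall_inP nolong.
by apply: base => // i iD; rewrite leqNgt nolong.
Qed.

Lemma keys_bound p D X Y :
  adversary_state p D X Y -> #|keys D X Y| <= M ^ #|~: D| * 4 ^ cost p.
Proof.
elim: p D X Y => [b|a p0 IH0 p1 IH1|a p0 IH0 p1 IH1].
- move=> D X Y [dec rX rY dj]; rewrite muln1.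
  have [D0|[l lD]] := set_0Vmem (~: D).
    (* With every coordinate erased, the constant [q0] is the only possible key. *)
    rewrite D0 cards0 expn0 -(cards1 [ffun _ : T => q0]).
    apply/subset_leq_card/subsetP => k; rewrite inE => /andP[/imsetP[x _ ->] _].
    rewrite inE; apply/eqP/ffunP => j; rewrite !ffunE.
    by have := in_set0 j; rewrite -D0 inE => /negbFE ->.
  have [->|[k]] := set_0Vmem (keys D X Y); first by rewrite cards0.
  rewrite inE => /andP[/imsetP[x xX ->] /imsetP[y yY /eqP/eraseP exy]].
  (* [x] and [y] agree off [D]: changing every such coordinate of [x] gives a no instance with [y],
     sparing [l] gives a yes instance, and a leaf cannot answer both. *)
  have [||x1 x1X [ne1 _]] := rich_move _ _ _ (enum (~: D)) rX xX.
  - exact: enum_uniq.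
  - by move=> j; rewrite mem_enum inE.
  have [||x2 x2X [ne2 eq2]] := rich_move _ _ _ (enum (~: D :\ l)) rX xX.
  - exact: enum_uniq.
  - by move=> j; rewrite mem_enum !inE => /andP[].
  have [no _] := dec _ _ x1X yY; have [_ yes] := dec _ _ x2X yY.
  have lD' : l \notin D by rewrite inE in lD.
  have bT : b = true.
    apply: (yes l); first by rewrite eq2 ?exy // mem_enum !inE eqxx.
    move=> i il; have [iD|iD] := boolP (i \in D); first exact: dj.
    by rewrite -exy // ne2 // mem_enum !inE il.
  suff bF : b = false by rewrite bF in bT.
  apply: no => i; have [iD|iD] := boolP (i \in D); first exact: dj.
  by rewrite -exy // ne1 // mem_enum !inE.
- apply: query_step => D X Y [dec rX rY dj] thin /=.
  apply: (bit_step D X Y [set x in X | ~~ a (eX x)] [set x in X | a (eX x)] Y Y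
    _ (cost p0) (cost p1)) => //.
  + by rewrite ltnS leq_maxl.
  + by rewrite ltnS leq_maxr.
  (* The key also comes from the unchanged [Y], so it survives on the side where [x] falls. *)
  + apply/subsetP => k; rewrite !inE => /andP[/imsetP[x xX ->] ->]; rewrite !andbT.
    by have [ax|ax] := boolP (a (eX x)); apply/orP; [right|left]; apply: imset_f;
       rewrite inE xX.
  + move=> X' Y' /subsetP sX /subsetP sY rX' rY'; apply: IH0; split=> //.
      move=> x y /sX; rewrite inE => /andP[xX /negbTE ax] /sY yY.
      by have := dec x y xX yY; rewrite /= ax.
    by move=> x y j /sX; rewrite inE => /andP[xX _] /sY; apply: dj.
  + move=> X' Y' /subsetP sX /subsetP sY rX' rY'; apply: IH1; split=> //.
      move=> x y /sX; rewrite inE => /andP[xX ax] /sY yY.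
      by have := dec x y xX yY; rewrite /= ax.
    by move=> x y j /sX; rewrite inE => /andP[xX _] /sY; apply: dj.
  + by rewrite subUset; apply/andP; split; apply/subsetP => x; rewrite inE => /andP[].
  + by rewrite setUid.
- apply: query_step => D X Y [dec rX rY dj] thin /=.
  apply: (bit_step D X Y X X [set y in Y | ~~ a (eY y)] [set y in Y | a (eY y)]
    _ (cost p0) (cost p1)) => //.
  + by rewrite ltnS leq_maxl.
  + by rewrite ltnS leq_maxr.
  + apply/subsetP => k; rewrite !inE => /andP[-> /imsetP[y yY ->]] /=.
    by have [ay|ay] := boolP (a (eY y)); apply/orP; [right|left]; apply: imset_f;
       rewrite inE yY.
  + move=> X' Y' /subsetP sX /subsetP sY rX' rY'; apply: IH0; split=> //.
      move=> x y /sX xX /sY; rewrite inE => /andP[yY /negbTE ay].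
      by have := dec x y xX yY; rewrite /= ay.
    by move=> x y j /sX xX /sY; rewrite inE => /andP[yY _]; apply: dj.
  + move=> X' Y' /subsetP sX /subsetP sY rX' rY'; apply: IH1; split=> //.
      move=> x y /sX xX /sY; rewrite inE => /andP[yY ay].
      by have := dec x y xX yY; rewrite /= ay.
    by move=> x y j /sX xX /sY; rewrite inE => /andP[yY _]; apply: dj.
  + by rewrite setUid.
  + by rewrite subUset; apply/andP; split; apply/subsetP => y; rewrite inE => /andP[].
Qed.

End Adversary.

End Erasure.

(** * Encoding tuples as sparse sets *)

Section SparseUniqueDisjointness.
Local Open Scope nat_scope.

Lemma det_cc_protocol (X Y : finType) (f : X -> Y -> option bool) :
  exists2 p, solves f p & cost p = det_cc f.
Proof.
rewrite /det_cc; case: ex_minnP => d /asboolP[p [sp cp]] _.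
by exists p.
Qed.

(** The graph of [x], with the pair [(i, a)] numbered [i * m + a]; numbers from [n] on are
    dropped. *)
Definition graph_ind (n s m : nat) (x : {ffun 'I_s -> 'I_m}) : {ffun 'I_n -> bool} :=
  [ffun l : 'I_n => [exists i : 'I_s, l == i * m + x i :> nat]].

Lemma block_index_inj (m i j a b : nat) : a < m -> b < m ->
  i * m + a = j * m + b -> i = j /\ a = b.
Proof.
move=> am bm e; have m0 : 0 < m by apply: leq_ltn_trans am.
have ij : i = j.
  by have := congr1 (divn^~ m) e; rewrite !divnMDl // !divn_small // !addn0.
by split=> //; move: e; rewrite ij => /addnI.
Qed.

Lemma graph_indI n s m (x y : {ffun 'I_s -> 'I_m}) (l : 'I_n) :
  graph_ind n s m x l -> graph_ind n s m y l ->
  exists2 i : 'I_s, l = i * m + x i :> nat & x i = y i.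
Proof.
rewrite !ffunE => /existsP[i /eqP lx] /existsP[j /eqP ly].
have [|/val_inj ij /val_inj xy] :=
  @block_index_inj m i j (x i) (y j) (ltn_ord _) (ltn_ord _); first by rewrite -lx.
by exists i; rewrite // xy ij.
Qed.

Lemma hamming_graph_ind n s m (x : {ffun 'I_s -> 'I_m}) :
  hamming_weight (graph_ind n s m x) <= s.
Proof.
rewrite /hamming_weight.
apply: (@leq_trans (\sum_(l < n) \sum_(i < s) (l == i * m + x i :> nat))).
  apply: leq_sum => l _; rewrite ffunE; case: existsP => // -[i e].
  by rewrite (bigD1 i) //= e.
rewrite exchange_big /= -[X in _ <= X]card_ord -sum1_card; apply: leq_sum => i _.
have [lt|ge] := ltnP (i * m + x i) n.
  rewrite (bigD1 (Ordinal lt)) //= eqxx big1 // => l ne.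
  by apply/eqP; rewrite eqb0.
rewrite big1 // => l _; apply/eqP; rewrite eqb0 neq_ltn.
by rewrite (leq_trans (ltn_ord l) ge).
Qed.

Lemma udisj_decides_or_eq n s m (p : protocol _ _) : s * m <= n ->
  solves (@udisj n s) p ->
  decides_or_eq _ _ _ _ (graph_ind n s m) (graph_ind n s m) [set: _] [set: _] p.
Proof.
move=> smn sp x y _ _; split=> [ne|l exy ne]; apply: sp.
  apply/udisj_noP; rewrite /udisj_no !hamming_graph_ind /=; apply/forallP => l.
  case xl: (graph_ind _ _ _ x l); case yl: (graph_ind _ _ _ y l) => //.
  by have [i _ e] := graph_indI _ _ _ _ _ _ xl yl; have := ne i; rewrite e eqxx.
apply/udisj_yesP; rewrite /udisj_yes !hamming_graph_ind /=; apply/existsP.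
have lt : l * m + x l < n.
  apply: leq_trans smn; apply: leq_trans (_ : l.+1 * m <= _); last first.
    by rewrite leq_mul2r ltn_ord orbT.
  by rewrite mulSn addnC ltn_add2r.
exists (Ordinal lt); apply/and3P; split.
- by rewrite ffunE; apply/existsP; exists l.
- by rewrite ffunE; apply/existsP; exists l; rewrite -exy.
apply/forall_inP => j jl.
case xj: (graph_ind _ _ _ x j); case yj: (graph_ind _ _ _ y j) => //.
have [i ej e] := graph_indI _ _ _ _ _ _ xj yj.
have [il|/ne] := eqVneq i l; last by rewrite e eqxx.
by case/eqP: jl; apply: val_inj; rewrite /= ej il.
Qed.

Lemma rich_setT (T Q : finType) (q0 : Q) : 1 < #|Q| -> @rich T Q q0 set0 setT.
Proof.
move=> Q1 x i _ _.
have /card_gt0P[q] : 0 < #|~: [set x i]| by rewrite cardsC1; lia.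
rewrite !inE => qx; exists [ffun j => if j == i then q else x j] => //.
split; first by rewrite ffunE eqxx.
by apply/eqP/eraseP => j; rewrite !inE orbF ffunE => /negbTE ->.
Qed.

Lemma udisj_block_bound n s m : s * m <= n ->
  m ^ s <= (16 * s) ^ s * 4 ^ det_cc (@udisj n s).
Proof.
move=> smn; have [s0|s0] := posnP s.
  by rewrite s0 !expn0 mul1n expn_gt0.
(* For [m <= 16 * s] the bound is trivial; otherwise [m > 1], which makes the full set of tuples
   rich. *)
have [ms|ms] := leqP m (16 * s).
  by rewrite (leq_trans (_ : _ <= (16 * s) ^ s)) ?leq_exp2r // leq_pmulr ?expn_gt0.
have m1 : 1 < m by lia.
have [p sp <-] := det_cc_protocol _ _ (@udisj n s).
pose q0 := Ordinal (ltnW m1).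
have := @keys_bound 'I_s 'I_m q0 _ _ (graph_ind n s m) (graph_ind n s m) (16 * s) _
  p set0 setT setT.
rewrite setC0 cardsT card_ord => /(_ (leqnn _)) bnd.
apply: leq_trans (bnd _); last first.
  split; [exact: udisj_decides_or_eq| | |by move=> x y j _ _; rewrite inE].
  - by apply: rich_setT; rewrite card_ord.
  - by apply: rich_setT; rewrite card_ord.
by rewrite keys_setT cardsT card_ffun !card_ord.
Qed.

(** * From counting to the logarithmic bound *)

Lemma udisj_power_bound n s : 0 < s -> s <= n ->
  n ^ s <= (32 * s ^ 2) ^ s * 4 ^ det_cc (@udisj n s).
Proof.
move=> s0 sn; have smn : s * (n %/ s) <= n by rewrite mulnC leq_divM.
have m0 : 0 < n %/ s by rewrite divn_gt0.
(* Since [s <= n], rounding [n / s] down loses at most a factor 2, which turns 16 into 32. *)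
have nle : n <= 2 * s * (n %/ s).
  have := divn_eq n s; have := ltn_pmod n s0; nia.
apply: (@leq_trans ((2 * s) ^ s * (n %/ s) ^ s)).
  by rewrite -expnMn leq_exp2r.
have -> : 32 * s ^ 2 = 2 * s * (16 * s) by lia.
by rewrite [(2 * s * _) ^ _]expnMn -mulnA leq_mul2l udisj_block_bound ?orbT.
Qed.

(** Serves the small [n], where the counting bound is too weak: a protocol without communication is
    constant, but two empty sets and two equal singletons need different answers. *)
Lemma udisj_det_cc_gt0 n s : 0 < n -> 0 < s -> 0 < det_cc (@udisj n s).
Proof.
move=> n0 s0; have [p sp <-] := det_cc_protocol _ _ (@udisj n s).
case: p sp => //= b sp.
pose z : {ffun 'I_n -> bool} := [ffun=> false].
pose e : {ffun 'I_n -> bool} := [ffun l => l == Ordinal n0].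
have wz : hamming_weight z <= s by rewrite /hamming_weight big1 // => i _; rewrite ffunE.
have we : hamming_weight e <= s.
  rewrite /hamming_weight (bigD1 (Ordinal n0)) //= big1 ?ffunE ?eqxx //.
  by move=> i /negbTE ne; rewrite ffunE ne.
have bF : b = false.
  apply: (sp z z); apply/udisj_noP; rewrite /udisj_no wz /=; apply/forallP => i.
  by rewrite ffunE.
suff bT : b = true by rewrite bF in bT.
apply: (sp e e); apply/udisj_yesP; rewrite /udisj_yes we /=; apply/existsP.
exists (Ordinal n0); rewrite ffunE eqxx /=; apply/forall_inP => i /negbTE ne.
by rewrite ffunE ne.
Qed.

End SparseUniqueDisjointness.

Theorem theorem1p3 (R : realType) (eps : R) (heps : 0 < eps) :
  exists c : R, 0 < c /\
    forall n s : nat, s%:R <= n%:R `^ (2^-1 - eps) ->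
      c * (s%:R * ln (n%:R / s%:R)) <= (det_cc (@udisj n s))%:R.
Proof.
(* [L] is the threshold for [ln n]: [c1] serves above it, [c2] below it, where [s <= expR L] and
   [ln (n / s) <= L]. *)
pose L : R := ln 32 / eps.
have ln32 : 0 < ln 32 :> R by rewrite ln_gt0 // ltr1n.
have ln4 : 0 < ln 4 :> R by rewrite ln_gt0 // ltr1n.
have L0 : 0 < L by rewrite divr_gt0.
pose c1 : R := eps / ln 4; pose c2 : R := (expR L * L)^-1.
have c10 : 0 < c1 by rewrite divr_gt0.
have c20 : 0 < c2 by rewrite invr_gt0 mulr_gt0 // expR_gt0.
exists (Num.min c1 c2); split; first by rewrite lt_min c10.
move=> n s.
have [->|s0] := posnP s; first by rewrite !mul0r mulr0 ler0n.
(* [ln] is 0 at 0, so the left side vanishes. *)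
have [->|n0] := posnP n; first by rewrite mul0r ln0 // !mulr0 ler0n.
move=> hs; set C : R := (det_cc _)%:R.
have sR : 0 < s%:R :> R by rewrite ltr0n.
have nR : 0 < n%:R :> R by rewrite ltr0n.
have lnn : 0 <= ln n%:R :> R by rewrite ln_ge0 // ler1n.
have lns : 0 <= ln s%:R :> R by rewrite ln_ge0 // ler1n.
have lsn : ln s%:R <= (2^-1 - eps) * ln n%:R.
  by rewrite -ln_powR ler_ln // posrE powR_gt0.
have lnsn : ln s%:R <= ln n%:R :> R by nra.
have sn : (s <= n)%N by rewrite -(ler_nat R) -ler_ln.
have /andP[lnB0 lnBn] : 0 <= ln (n%:R / s%:R : R) <= ln n%:R.
  by rewrite ln_div ?posrE // subr_ge0 lnsn lerBlDr lerDl.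
have sB0 : 0 <= s%:R * ln (n%:R / s%:R) :> R by rewrite mulr_ge0 // ltW.
have [big|small] := leP (ln 32) (eps * ln n%:R).
  have key : s%:R * ln n%:R <= s%:R * (ln 32 + 2 * ln s%:R) + C * ln 4.
    have pow : n%:R ^+ s <= (32 * s%:R ^+ 2) ^+ s * 4 ^+ det_cc (@udisj n s) :> R.
      by rewrite -!natrX -natrM -natrX -natrM ler_nat udisj_power_bound.
    rewrite /C !mulr_natl; move: pow; rewrite -ler_ln ?posrE ?mulr_gt0 ?exprn_gt0 // ?mulr_gt0 ?exprn_gt0 //.
    rewrite lnM ?posrE ?exprn_gt0 ?mulr_gt0 ?exprn_gt0 //.
    rewrite !lnXn ?mulr_gt0 ?exprn_gt0 // lnM ?posrE ?exprn_gt0 //.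
    by rewrite lnXn.
  apply: (@le_trans _ _ (c1 * (s%:R * ln n%:R))).
    by rewrite ler_pM // ?le_min ?ge_min ?lexx ?(ltW c10) ?(ltW c20) // ler_pM2l.
  clearbody C; clear hs; rewrite /c1 mulrAC ler_pdivrMr //.
  (* [2 * ln s <= (1 - 2 * eps) * ln n] leaves [2 * eps * ln n - ln 32], at least [eps * ln n] in
     this case. *)
  have step : s%:R * (eps * ln n%:R) <= s%:R * (ln n%:R - ln 32 - 2 * ln s%:R).
    by rewrite ler_pM2l //; lra.
  lra.
have C1 : 1 <= C by rewrite ler1n udisj_det_cc_gt0.
have nL : ln n%:R <= L by rewrite ler_pdivlMr // mulrC ltW.
have sL : s%:R <= expR L by rewrite -[s%:R]lnK ?posrE // ler_expR (le_trans lnsn).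
have EL0 : expR L * L != 0 by rewrite gt_eqF // mulr_gt0 // expR_gt0.
apply: le_trans C1; rewrite [X in _ <= X](_ : 1 = c2 * (expR L * L)); last by rewrite mulVf.
apply: ler_pM => //.
- by rewrite le_min !ltW.
- by rewrite ge_min lexx orbT.
- by rewrite ler_pM ?(ltW sR) // (le_trans lnBn).
Qed.
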